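(* Let $\mathbf{f}=\mathbf{f}(x,\mathbf{w})\in\mathcal{P}_n[x]$ be a $\mathbb{C}^d$-valued polynomial, homogeneous of degree $n$ in $\mathbf{w}$ and of degree $k$ in $x$. Then there exist $\mathbf{q}_0,\dots,\mathbf{q}_k\in\mathcal{P}_n$ such that $$\mathbf{f}(x,\mathbf{w})=\sum_{j=0}^k\mathbf{P}_j(x)\,\mathbf{q}_j(\mathbf{w}),$$ and this representation is unique.
   Context: Let $d\ge1$ and let $A,B$ be $d\times d$ complex matrices such that (i) $A+B$ is diagonalizable, and (ii) (nonresonance) the eigenvalues $\lambda_1,\dots,\lambda_d$ of $A+B$ (listed with multiplicity), with $\boldsymbol{\lambda}=(\lambda_1,\dots,\lambda_d)$, satisfy $\mathbf{m}\cdot\boldsymbol{\lambda}-\lambda_j\notin\mathbb{Z}_-=\{-1,-2,-3,\dots\}$ for all $\mathbf{m}\in\mathbb{N}^d$ and $j=1,\dots,d$, where $\mathbb{N}=\{0,1,2,\dots\}$. Put $M(x)=\frac{1}{x-1}A+\frac{1}{x+1}B$ and $Q(x)=x^2-1$. Let $Y$ be a fundamental matrix of solutions of $\mathbf{y}'=M\mathbf{y}$ (so $Y'=MY$, $Y$ invertible), taken locally near a point $x\in\mathbb{C}\setminus\{\pm1\}$. For $n\in\mathbb{N}$, let $\mathcal{P}_n$ be the space of $\mathbb{C}^d$-valued polynomials $\mathbf{q}(\mathbf{w})$ in $\mathbf{w}=(w_1,\dots,w_d)$ that are homogeneous of degree $n$; $\mathcal{P}_n[x]$ denotes polynomials in $x$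 with coefficients in $\mathcal{P}_n$. For $k\ge0$ the linear operator $\mathbf{P}_k(x)$ on $\mathcal{P}_n$ is defined by $$\mathbf{P}_k(x)\mathbf{q}(\mathbf{w})=Y(x)\,\frac{d^k}{dt^k}\Big|_{t=x}\left[Q(t)^k\,Y^{-1}(t)\,\mathbf{q}\left(Y(t)Y^{-1}(x)\mathbf{w}\right)\right];$$ it is a polynomial in $x$ of degree $k$ with coefficients linear operators on $\mathcal{P}_n$. *)

(* Defs.v *)
From HB Require Import structures.
From mathcomp Require Import all_boot all_order all_algebra.
From mathcomp Require Import complex.
From mathcomp Require Import all_classical all_reals all_analysis.
(* The notations of mpoly clash with those of mathcomp-analysis; its canonical
   structures are needed. *)
From mathcomp Require Import (canonicals) mpoly.

Set Implicit Arguments.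
Unset Strict Implicit.
Unset Printing Implicit Defensive.

Import Order.TTheory GRing.Theory Num.Theory.
Import numFieldNormedType.Exports.

Local Open Scope classical_set_scope.
Local Open Scope ring_scope.

Definition Mmat (K : numFieldType) (d : nat) (A B : 'M[K]_d) (x : K) : 'M[K]_d :=
  (x - 1)^-1 *: A + (x + 1)^-1 *: B.

Definition Qpol (K : numFieldType) (x : K) : K := x ^+ 2 - 1.

(* For K = R[i], [derivable] and [derive1] are complex differentiability and
   the complex derivative; matrices are differentiated entrywise. *)
Definition fundamental_near (K : numFieldType) (d : nat) (A B : 'M[K]_d)
    (x : K) (Y : K -> 'M[K]_d) : Prop :=
  \forall t \near x,
    Y t \in unitmx /\
    forall i j, derivable (fun s : K => Y s i j : K) t 1 /\
      derive1 (fun s : K => Y s i j : K) t = (Mmat A B t *m Y t) i j.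

(* [lam] lists the eigenvalues of S with multiplicity. *)
Definition eigenvalue_list (K : numFieldType) (d : nat) (S : 'M[K]_d)
    (lam : 'I_d -> K) : Prop :=
  char_poly S = \prod_(i < d) ('X - (lam i)%:P).

Definition nonresonant (K : numFieldType) (d : nat) (lam : 'I_d -> K) : Prop :=
  forall (m : 'I_d -> nat) (j : 'I_d) (p : nat),
    \sum_(i < d) (m i)%:R * lam i - lam j != - (p.+1)%:R.

(* C^d-valued polynomials in w = (w_1, ..., w_d), given by their components. *)
Definition vpoly (K : numFieldType) (d : nat) : Type := 'cV[mpoly.mpoly d K]_d.

(* Membership in the space P_n (which contains 0). *)
Definition in_Pn (K : numFieldType) (d n : nat) (q : vpoly K d) : Prop :=
  forall i, q i 0 \is mpoly.ishomog1 n (mpoly.Measure.clone d (@mpoly.mdeg d) _).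

Definition veval (K : numFieldType) (d : nat) (q : vpoly K d) (w : 'cV[K]_d) :
    'cV[K]_d :=
  \col_i mpoly.meval (fun l => w l 0) (q i 0).

(* C^d-valued polynomials in x and w. *)
Definition vxpoly (K : numFieldType) (d : nat) : Type :=
  'cV[{poly (mpoly.mpoly d K)}]_d.

(* Membership in P_n[x]. *)
Definition in_Pnx (K : numFieldType) (d n : nat) (f : vxpoly K d) : Prop :=
  forall i l, (f i 0)`_l \is mpoly.ishomog1 n (mpoly.Measure.clone d (@mpoly.mdeg d) _).

Definition xdeg_le (K : numFieldType) (d k : nat) (f : vxpoly K d) : Prop :=
  forall i, (size (f i 0%R) <= k.+1)%N.

Definition vxeval (K : numFieldType) (d : nat) (f : vxpoly K d) (x : K)
    (w : 'cV[K]_d) : 'cV[K]_d :=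
  veval (\col_i (f i 0).[mpoly.mpolyC d x]) w.

(* The vector P_k(x)q(w), computed with a fundamental matrix Y near x; the
   k-th derivative at t = x is taken componentwise. *)
Definition Pop (K : numFieldType) (d : nat) (Y : K -> 'M[K]_d) (k : nat)
    (x : K) (q : vpoly K d) (w : 'cV[K]_d) : 'cV[K]_d :=
  Y x *m \col_i derive1n k
    (fun t : K => (Qpol t ^+ k *:
       (invmx (Y t) *m veval q (Y t *m invmx (Y x) *m w))) i 0 : K) x.

(* Main.v *)
Require Import Defs.
From HB Require Import structures.
From mathcomp Require Import all_boot all_order all_algebra.
From mathcomp Require Import complex.
From mathcomp Require Import all_classical all_reals all_analysis.
From mathcomp Require Import -(notations) mpoly.
From mathcomp Require Import perm ring zify.

Set Implicit Arguments.
Unset Strict Implicit.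
Unset Printing Implicit Defensive.

Import Order.TTheory GRing.Theory Num.Theory.
Import numFieldNormedType.Exports.
Local Open Scope ring_scope.

(** Write S = A + B, C = A - B and v = Y(x)^-1 w.  The point is that the
    derivatives in the definition of P_k can be carried out by an algebraic
    recurrence.  If r(t, w) is a vector of polynomials and M is the coefficient
    matrix of the equation, then Y' = M Y and (Y^-1)' = - Y^-1 M give

      d/dt [ Y^-1 r(t, Y v) ] = Y^-1 (r_t + L_M r)(t, Y v),

    where L_M r(w) = (D_w r)(w)[M w] - M r(w) is the Lie bracket with the linear
    vector field w |-> M w.  As Q M = x S + C is polynomial, a factor Q^e in
    front turns into Q^(e-1), and

      d/dt [ Q^e Y^-1 r(t, Y v) ] = Q^(e-1) Y^-1 r~(t, Y v),
      r~ = 2 e x r + (x^2 - 1) r_x + x L_S r + L_C r.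

    Starting from Q^k Y^-1 q(Y v), k such steps eliminate Q, and P_k q is a
    polynomial ([PopE]).  One step raises the degree j in x by one and acts on
    the top coefficient by 2 (k - j) + j + L_S ([vcoef_pstage_lead]).  Therefore
    the coefficient of x^k in P_k q is the image of q under the product of the
    operators c + L_S for k < c <= 2 k.

    Each of these factors is bijective on P_n.  Linear changes of the variable w
    conjugate L_S to L_D with D diagonal ([lie_transport]), and w^m e_j is an
    eigenvector of L_D with eigenvalue m . lambda - lambda_j, which is never
    equal to -c by nonresonance.

    Existence and uniqueness follow by induction on the degree in x: the top
    coefficient of f determines q_k, and f - P_k q_k has lower degree
    ([ppoly_expansion], [ppoly_sum_inj]).  Uniqueness also uses that a
    polynomial in (x, w) is determined by its values at the points with x
    different from 1 and -1 ([vxeval_inj]). *)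

(** * Linear vector fields acting on polynomials *)

Section LinearVectorFields.
Variables (K : comNzRingType) (d : nat).
Implicit Types (S N P D : 'M[K]_d) (p : mpoly d K).

Local Notation "''x_' i" := (mpolyX K (mnm1 i)) (at level 8, i at level 2).

(** Identities between ring morphisms and derivations on polynomials need to be
    checked only on constants and variables. *)
Lemma mpoly_gen_ind (Pr : mpoly d K -> Prop) :
  (forall c, Pr (mpolyC d c)) -> (forall i, Pr 'x_i) ->
  (forall p q, Pr p -> Pr q -> Pr (p + q)) ->
  (forall p q, Pr p -> Pr q -> Pr (p * q)) -> forall p, Pr p.
Proof.
move=> PrC PrX PrD PrM; elim/mpolyind => [|c m p _ _ Prp].
  by rewrite -(mpolyC0 d K).
apply: (PrD _ _ _ Prp); rewrite -mul_mpolyC; apply: (PrM _ _ (PrC c)).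
rewrite mpolyXE_id; apply: big_ind => [|//|i _]; first exact: PrC.
by elim: (m i) => [|e IHe]; [exact: PrC | rewrite exprS; apply: PrM].
Qed.

Definition linform S l : mpoly d K := \sum_m S l m *: 'x_m.

(** The directional derivative p |-> (D p)(w)[S w] along the linear vector
    field w |-> S w. *)
Definition lder S p : mpoly d K := \sum_l linform S l * mderiv l p.

Lemma lder_is_linear S : linear (lder S).
Proof.
move=> c p q; rewrite /lder scaler_sumr -big_split; apply: eq_bigr => l _ /=.
by rewrite mderivD mderivZ mulrDr scalerAr.
Qed.

HB.instance Definition _ S :=
  GRing.isLinear.Build K (mpoly d K) (mpoly d K) _ (lder S) (lder_is_linear S).

Lemma lderC S c : lder S (mpolyC d c) = 0.
Proof. by rewrite /lder big1 // => l _; rewrite mderivC mulr0. Qed.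

Lemma lderM S p q : lder S (p * q) = lder S p * q + p * lder S q.
Proof.
rewrite /lder mulr_suml mulr_sumr -big_split; apply: eq_bigr => l _ /=.
by rewrite mderivM; ring.
Qed.

Lemma mderiv_var (l i : 'I_d) : mderiv l 'x_i = (i == l)%:R.
Proof.
rewrite mderivX mnm1E; case: eqP => [->|_]; last by rewrite scale0r.
rewrite scale1r (_ : mnm_sub _ _ = mnm0) ?mpolyX0 //.
by apply/mnmP => j; rewrite mnmBE subnn mnmE.
Qed.

Lemma lderX S i : lder S 'x_i = linform S i.
Proof.
rewrite /lder (bigD1 i) //= mderiv_var eqxx mulr1 big1 ?addr0 // => l neq_li.
by rewrite mderiv_var eq_sym (negbTE neq_li) mulr0.
Qed.

Lemma lder_scale_add S S' a b p :
  lder (a *: S + b *: S') p = a *: lder S p + b *: lder S' p.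
Proof.
rewrite /lder !scaler_sumr -big_split; apply: eq_bigr => l _ /=.
rewrite !scalerAl -mulrDl; congr (_ * _); rewrite /linform !scaler_sumr.
by rewrite -big_split; apply: eq_bigr => m _ /=; rewrite !mxE scalerDl !scalerA.
Qed.

Lemma mulX_mderivX (l : 'I_d) (m : multinom d) :
  'x_l * mderiv l (mpolyX K m) = (m l)%:R *: mpolyX K m.
Proof.
rewrite mderivX -scalerAr -mpolyXD addmC.
have [->|ml_neq0] := eqVneq (m l) 0%N; first by rewrite !scale0r.
by rewrite submK // lep1mP.
Qed.

Definition linsubst P p : mpoly d K := comp_mpoly [tuple linform P l | l < d] p.

HB.instance Definition _ P := GRing.Linear.copy (linsubst P)
  (comp_mpoly [tuple linform P l | l < d]).
HB.instance Definition _ P := GRing.RMorphism.copy (linsubst P)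
  (comp_mpoly [tuple linform P l | l < d]).

Lemma linsubstX P i : linsubst P 'x_i = linform P i.
Proof. by rewrite /linsubst comp_mpolyXU -tnth_nth tnth_mktuple. Qed.

Lemma linsubstC P c : linsubst P (mpolyC d c) = mpolyC d c.
Proof. exact: comp_mpolyC. Qed.

Lemma linsubst_linform P S l : linsubst P (linform S l) = linform (S *m P) l.
Proof.
rewrite linear_sum /=.
under eq_bigr => m _ do rewrite linearZ /= linsubstX /linform scaler_sumr.
rewrite exchange_big; apply: eq_bigr => m _ /=.
by rewrite mxE scaler_suml; apply: eq_bigr => i _; rewrite scalerA.
Qed.

Lemma lder_linform P S l : lder S (linform P l) = linform (P *m S) l.
Proof.
rewrite linear_sum /=.
under eq_bigr => m _ do rewrite linearZ /= lderX /linform scaler_sumr.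
rewrite exchange_big; apply: eq_bigr => m _ /=.
by rewrite mxE scaler_suml; apply: eq_bigr => i _; rewrite scalerA.
Qed.

Lemma linsubst1 p : linsubst 1%:M p = p.
Proof.
elim/mpoly_gen_ind: p => [c|i|p q Hp Hq|p q Hp Hq].
- exact: linsubstC.
- rewrite linsubstX /linform (bigD1 i) //= mxE eqxx scale1r big1 ?addr0 //.
  by move=> j neq_ji; rewrite mxE eq_sym (negbTE neq_ji) scale0r.
- by rewrite linearD /= Hp Hq.
- by rewrite rmorphM /= Hp Hq.
Qed.

Lemma linsubst_comp P P' p :
  linsubst P (linsubst P' p) = linsubst (P' *m P) p.
Proof.
elim/mpoly_gen_ind: p => [c|i|p q Hp Hq|p q Hp Hq].
- by rewrite !linsubstC.
- by rewrite !linsubstX linsubst_linform.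
- by rewrite !linearD /= Hp Hq.
- by rewrite !rmorphM /= Hp Hq.
Qed.

(** The chain rule: the derivative of p(P w) along S w is (D p)(P w)[P S w], and
    P S w = D (P w). *)
Lemma lder_linsubst P S D p : P *m S = D *m P ->
  lder S (linsubst P p) = linsubst P (lder D p).
Proof.
move=> PS; elim/mpoly_gen_ind: p => [c|i|p q Hp Hq|p q Hp Hq].
- by rewrite linsubstC !lderC linear0.
- by rewrite linsubstX lderX lder_linform linsubst_linform PS.
- by rewrite !linearD /= Hp Hq.
- by rewrite rmorphM !lderM /= Hp Hq linearD /= !rmorphM.
Qed.

Local Notation homog n p := (p \is ishomog1 n (Measure.clone d (@mdeg d) _)).

Lemma dhomog_linform P l : homog 1 (linform P l).
Proof.
apply: rpred_sum => m _; apply: rpredZ; rewrite dhomogX.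
by apply/eqP; exact: mdeg1.
Qed.

Lemma dhomog_linsubst n P p : homog n p -> homog n (linsubst P p).
Proof.
move=> /dhomogP hp; rewrite /linsubst comp_mpolyEX big_seq.
apply: rpred_sum => m /hp mn; apply: rpredZ; rewrite comp_mpolyX -mn /= mdegE.
apply: (big_ind2 (fun r e => homog e r)) => [|p1 e1 p2 e2|i _].
- exact: dhomog1.
- exact: dhomogM.
- rewrite tnth_mktuple -[X in ishomog1 X]mul1n.
  exact/dhomogMn/dhomog_linform.
Qed.

(** The operators w_a d/dw_l keep the degree of a monomial, or kill it. *)
Lemma dhomog_lder n S p : homog n p -> homog n (lder S p).
Proof.
move=> /dhomogP hp; rewrite [p]mpolyE linear_sum big_seq.
apply: rpred_sum => m /hp /= mn; rewrite linearZ /=; apply: rpredZ.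
apply: rpred_sum => l _; rewrite mderivX.
have [->|ml_neq0] := eqVneq (m l) 0%N; first by rewrite scale0r mulr0 rpred0.
rewrite -scalerAr; apply: rpredZ.
have -> : n = (1 + mdeg (mnm_sub m (mnm1 l)))%N.
  by rewrite -(@mdeg1 d l) -mdegD addmC submK // lep1mP.
by apply: dhomogM; [exact: dhomog_linform | rewrite dhomogX].
Qed.

End LinearVectorFields.

(** * The bracket with a linear vector field *)

Section Lie.
Variables (K : comNzRingType) (d : nat).
Implicit Types (S N P D : 'M[K]_d) (p : mpoly d K) (q : 'cV[mpoly d K]_d).

Definition cmx m n (N : 'M[K]_(m, n)) : 'M[mpoly d K]_(m, n) :=
  map_mx (mpolyC d (R := K)) N.

(** The Lie bracket (D q)(w)[S w] - S q(w). *)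
Definition lie S q := map_mx (lder S) q - cmx S *m q.

(** The vector field N q(P w).  For N the inverse of P this is q written in
    other linear coordinates. *)
Definition transport N P q := cmx N *m map_mx (linsubst P) q.

Lemma cmxM S N : cmx (S *m N) = cmx S *m cmx N.
Proof. exact: map_mxM. Qed.

Lemma lie_is_zmod_morphism S : zmod_morphism (lie S).
Proof. by move=> q r; rewrite /lie map_mxB mulmxBr !opprD !opprK addrACA. Qed.

HB.instance Definition _ S := GRing.isZmodMorphism.Build 'cV[mpoly d K]_d
  'cV[mpoly d K]_d (lie S) (lie_is_zmod_morphism S).

Lemma transport_is_zmod_morphism N P : zmod_morphism (transport N P).
Proof. by move=> q r; rewrite /transport map_mxB mulmxBr. Qed.

HB.instance Definition _ N P := GRing.isZmodMorphism.Build 'cV[mpoly d K]_d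
  'cV[mpoly d K]_d (transport N P) (transport_is_zmod_morphism N P).

Lemma lder_cmx S N q :
  map_mx (lder S) (cmx N *m q) = cmx N *m map_mx (lder S) q.
Proof.
apply/matrixP => i j; rewrite !mxE linear_sum; apply: eq_bigr => l _ /=.
by rewrite !mxE lderM lderC mul0r add0r.
Qed.

Lemma linsubst_cmx P N q :
  map_mx (linsubst P) (cmx N *m q) = cmx N *m map_mx (linsubst P) q.
Proof.
apply/matrixP => i j; rewrite !mxE linear_sum; apply: eq_bigr => l _ /=.
by rewrite rmorphM /= !mxE linsubstC.
Qed.

Lemma lie_transport S D N P q : P *m S = D *m P -> S *m N = N *m D ->
  lie S (transport N P q) = transport N P (lie D q).
Proof.
move=> PS SN; rewrite /lie /transport map_mxB mulmxBr linsubst_cmx lder_cmx.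
rewrite !mulmxA -!cmxM SN; congr (_ *m _ - _).
by apply/matrixP => i j; rewrite !mxE (lder_linsubst _ PS).
Qed.

Lemma transport_comp N P N' P' q :
  transport N P (transport N' P' q) = transport (N *m N') (P' *m P) q.
Proof.
rewrite /transport linsubst_cmx mulmxA -cmxM; congr (_ *m _).
by apply/matrixP => i j; rewrite !mxE linsubst_comp.
Qed.

Lemma transport1 q : transport 1%:M 1%:M q = q.
Proof.
rewrite /transport /cmx map_mx1 mul1mx.
by apply/matrixP => i j; rewrite mxE linsubst1.
Qed.

(** Monomials diagonalize a diagonal vector field. *)
Lemma lder_diagX (a : 'rV[K]_d) (m : multinom d) :
  lder (diag_mx a) (mpolyX K m) = (\sum_l a 0 l *+ m l) *: mpolyX K m.
Proof.
rewrite /lder scaler_suml; apply: eq_bigr => l _.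
rewrite /linform (bigD1 l) //= big1 => [|i neq_il].
  by rewrite addr0 mxE eqxx mulr1n -scalerAl mulX_mderivX scalerA mulr_natr.
by rewrite mxE eq_sym (negbTE neq_il) scale0r.
Qed.

Lemma mcoeff_lder_diag (a : 'rV[K]_d) p (m : multinom d) :
  mcoeff m (lder (diag_mx a) p) = (\sum_l a 0 l *+ m l) * mcoeff m p.
Proof.
elim/mpolyind: p => [|c m' p _ _ IHp]; first by rewrite linear0 mcoeff0 mulr0.
rewrite linearP /= mcoeffD mcoeffZ IHp lder_diagX mcoeffD !mcoeffZ mcoeffX.
rewrite mulrDr.
by congr (_ + _); case: eqP => [->|_]; rewrite ?mulr0 // !mulr1 mulrC.
Qed.

Lemma lie_diagE (a : 'rV[K]_d) q i :
  lie (diag_mx a) q i 0 = lder (diag_mx a) (q i 0) - a 0 i *: q i 0.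
Proof.
rewrite !mxE; congr (_ - _); rewrite (bigD1 i) //= big1 => [|j neq_ji].
  by rewrite addr0 !mxE eqxx mulr1n mul_mpolyC.
by rewrite !mxE eq_sym (negbTE neq_ji) mpolyC0 mul0r.
Qed.

Definition homogv n q :=
  forall i, q i 0 \is ishomog1 n (Measure.clone d (@mdeg d) _).

Lemma homogv_cmx n N q : homogv n q -> homogv n (cmx N *m q).
Proof.
move=> hq i; rewrite mxE; apply: rpred_sum => j _.
by rewrite mxE mul_mpolyC; exact: rpredZ.
Qed.

Lemma homogv_lie n S q : homogv n q -> homogv n (lie S q).
Proof.
move=> hq i; rewrite mxE [X in _ + X]mxE.
by apply: rpredB; [rewrite mxE; exact: dhomog_lder | exact: homogv_cmx].
Qed.

Lemma homogv_transport n N P q : homogv n q -> homogv n (transport N P q).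
Proof.
by move=> hq; apply: homogv_cmx => i; rewrite mxE; exact: dhomog_linsubst.
Qed.

End Lie.

(** * Inverting c + L_S for diagonalizable S *)

Section Nonresonant.
Variables (K : fieldType) (d : nat).
Implicit Types (S P : 'M[K]_d) (q g : 'cV[mpoly d K]_d).

(** On the coefficient of w^m in component i the operator is multiplication by
    c + (m . a) - a_i. *)
Lemma lie_diag_inj (a : 'rV[K]_d) c q :
  (forall (m : 'I_d -> nat) i, c%:R + (\sum_l a 0 l *+ m l - a 0 i) != 0) ->
  q *+ c + lie (diag_mx a) q = 0 -> q = 0.
Proof.
move=> nres /matrixP q0; apply/matrixP => i j; rewrite (ord1 j) mxE.
apply/mpolyP => m; have := congr1 (mcoeff m) (q0 i 0).
rewrite [X in mcoeff m X = _]mxE lie_diagE mulmxnE mcoeffD mcoeffB mcoeffMn.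
rewrite mcoeffZ mcoeff_lder_diag -mulr_natl -mulrBl -mulrDl.
rewrite [X in _ = mcoeff m X]mxE !mcoeff0 => /eqP.
by rewrite mulf_eq0 (negbTE (nres _ i)) => /eqP.
Qed.

Lemma lie_diag_surj n (a : 'rV[K]_d) c g :
  (forall (m : 'I_d -> nat) i, c%:R + (\sum_l a 0 l *+ m l - a 0 i) != 0) ->
  homogv n g -> exists2 q, homogv n q & q *+ c + lie (diag_mx a) q = g.
Proof.
move=> nres hg.
pose mu i (m : multinom d) := c%:R + (\sum_l a 0 l *+ m l - a 0 i).
exists (\col_i \sum_(m <- msupp (g i 0))
          (mcoeff m (g i 0) / mu i m) *: mpolyX K m).
  move=> i; rewrite mxE big_seq; apply: rpred_sum => m m_g; apply: rpredZ.
  by rewrite dhomogX; apply/eqP/(dhomogP _ _ _ (hg i)).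
apply/matrixP => i j; rewrite (ord1 j) mxE lie_diagE mulmxnE mxE.
rewrite [RHS]mpolyE linear_sum /= -sumrMnl scaler_sumr -sumrB -big_split.
apply: eq_bigr => m _ /=; rewrite linearZ /= lder_diagX -scaler_nat !scalerA.
rewrite -scalerBl -scalerDl; congr (_ *: _).
have := nres m i; rewrite -/(mu i m) => mu_neq0.
rewrite [in X in _ + (_ - X)]mulrC -mulrBr [c%:R * _]mulrC -mulrDr.
by rewrite -/(mu i m) divfK.
Qed.

(** Solve in the coordinates P w, where S becomes diagonal, and come back. *)
Lemma lie_diagonalizable_surj n S c P (a : 'rV[K]_d) g :
  P \in unitmx -> P *m S = diag_mx a *m P ->
  (forall (m : 'I_d -> nat) i, c%:R + (\sum_l a 0 l *+ m l - a 0 i) != 0) ->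
  homogv n g -> exists2 q, homogv n q & q *+ c + lie S q = g.
Proof.
move=> Pu PS nres hg; pose N := invmx P.
have SN : S *m N = N *m diag_mx a.
  by rewrite -[S](mulKmx Pu) PS -mulmxA mulmxK.
have [h hh hE] := lie_diag_surj nres (homogv_transport P N hg).
exists (transport N P h); first exact: homogv_transport.
rewrite (lie_transport _ PS SN) -raddfMn -raddfD hE /= transport_comp.
by rewrite mulVmx // transport1.
Qed.

Lemma lie_diagonalizable_inj S c P (a : 'rV[K]_d) q q' :
  P \in unitmx -> P *m S = diag_mx a *m P ->
  (forall (m : 'I_d -> nat) i, c%:R + (\sum_l a 0 l *+ m l - a 0 i) != 0) ->
  q *+ c + lie S q = q' *+ c + lie S q' -> q = q'.
Proof.
move=> Pu PS nres /eqP; rewrite -subr_eq0 opprD addrACA -mulrnBl -raddfB.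
move=> /eqP eq0; apply/eqP; rewrite -subr_eq0; move: (q - q') eq0 => {q q'} q.
move=> eq0; pose N := invmx P.
have NS : N *m diag_mx a = S *m N.
  by rewrite -[S](mulKmx Pu) PS -mulmxA mulmxK.
have Nu : N *m P = 1%:M by rewrite mulVmx.
suff q0 : transport P N q = 0.
  by apply/eqP; rewrite -[q]transport1 -Nu -transport_comp q0 raddf0.
apply: (lie_diag_inj nres); rewrite (@lie_transport _ _ _ S) //.
by rewrite -raddfMn -raddfD eq0 raddf0.
Qed.

(** The rows of P are eigenvectors of S for the diagonal entries a_i. *)
Lemma diagonalization_spectrum S P (a : 'rV[K]_d) (lam : 'I_d -> K) :
  P \in unitmx -> P *m S = diag_mx a *m P ->
  char_poly S = \prod_(i < d) ('X - (lam i)%:P) ->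
  exists s : 'I_d -> 'I_d, forall i, a 0 i = lam (s i).
Proof.
move=> Pu PS charS.
suff /fin_all_exists : forall i, exists j, a 0 i = lam j by [].
move=> i.
have /eigenvalueP : exists2 v : 'rV[K]_d, v *m S = a 0 i *: v & v != 0.
  exists (row i P); first
    by rewrite -row_mul PS row_mul row_diag_mx -scalemxAl -rowE.
  apply: contraTneq Pu => Pi0; apply/negP => Pu; have := mulmxV Pu.
  move/(congr1 (row i)); rewrite row_mul Pi0 mul0mx row1 => /rowP/(_ i).
  by rewrite !mxE !eqxx => /eqP; rewrite eq_sym oner_eq0.
rewrite eigenvalue_root_char charS /root horner_prod.
by case/prodf_eq0=> j _; rewrite !hornerE subr_eq0 => /eqP ->; exists j.
Qed.

End Nonresonant.

(** * The recurrence for the operators P_k *)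

Section Recurrence.
Variables (K : comNzRingType) (d : nat) (S C : 'M[K]_d).
Local Notation vec := 'cV[mpoly d K]_d.
Local Notation xvec := 'cV[{poly mpoly d K}]_d.
Implicit Types (q g : vec) (r f : xvec).

Definition vcoef l r : vec := map_mx (fun p : {poly mpoly d K} => p`_l) r.

Lemma vcoef_is_zmod_morphism l : zmod_morphism (vcoef l).
Proof. by move=> r f; apply/matrixP => i j; rewrite !mxE coefB. Qed.

HB.instance Definition _ l := GRing.isZmodMorphism.Build xvec vec (vcoef l)
  (vcoef_is_zmod_morphism l).

Lemma vcoefP r f : (forall l, vcoef l r = vcoef l f) -> r = f.
Proof.
move=> rf; apply/matrixP => i j; apply/polyP => l.
by have /matrixP/(_ i j) := rf l; rewrite !mxE.
Qed.

Definition xlie (T : 'M[K]_d) r : xvec :=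
  map_mx (map_poly (lder T)) r - map_mx polyC (cmx d T) *m r.

Lemma vcoef_xlie T r l : vcoef l (xlie T r) = lie T (vcoef l r).
Proof.
apply/matrixP => i j; rewrite !mxE coefB coef_map; congr (_ - _).
by rewrite coef_sum; apply: eq_bigr => m _; rewrite !mxE coefCM.
Qed.

(** If F = Q^e Y^-1 r(t, Y v) and c = 2 e, then F' = Q^(e-1) Y^-1 r~(t, Y v)
    with r~ the value below: c x r comes from (Q^e)' = 2 e x Q^(e-1), and
    Q (r_x + L_M r) gives the other terms because Q M = x S + C. *)
Definition pstep c r : xvec :=
  'X *: (r *+ c + xlie S r) + ('X^2 - 1) *: map_mx deriv r + xlie C r.

Lemma vcoefX r l :
  vcoef l ('X *: r) = if l is l'.+1 then vcoef l' r else 0.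
Proof.
by apply/matrixP => i j; case: l => [|l]; rewrite !mxE coefXM.
Qed.

Lemma vcoef_deriv r l : vcoef l (map_mx deriv r) = vcoef l.+1 r *+ l.+1.
Proof. by apply/matrixP => i j; rewrite mulmxnE !mxE coef_deriv. Qed.

Lemma pstepE c r : pstep c r = 'X *: (r *+ c + xlie S r)
  + ('X *: ('X *: map_mx deriv r) - map_mx deriv r) + xlie C r.
Proof. by rewrite scalerA -expr2 -[X in _ - X]scale1r -scalerBl. Qed.

Lemma vcoef_pstep0 c r :
  vcoef 0 (pstep c r) = lie C (vcoef 0 r) - vcoef 1 r.
Proof.
rewrite pstepE -vcoef_xlie; move: (xlie C r) (xlie S r) => u v.
by rewrite !raddfD raddfN /= !vcoefX vcoef_deriv !add0r addrC.
Qed.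

Lemma vcoef_pstepS c r l :
  vcoef l.+1 (pstep c r) = vcoef l r *+ (c + l) + lie S (vcoef l r)
    - vcoef l.+2 r *+ l.+2 + lie C (vcoef l.+1 r).
Proof.
rewrite pstepE -!vcoef_xlie; move: (xlie C r) (xlie S r) => u v.
rewrite !(raddfD (vcoef _)) (raddfN (vcoef _)) /= !vcoefX
  vcoef_deriv (raddfD (vcoef _)) (raddfMn (vcoef _)) /=.
rewrite addrA mulrnDr; congr (_ - _ + _); rewrite addrAC; congr (_ + _).
by congr (_ + _); case: l => [|l] //; rewrite vcoef_deriv.
Qed.

(** For j <= k, the j-th derivative of Q^k Y^-1 q(Y v) is
    Q^(k-j) Y^-1 (pstage k q j)(t, Y v). *)
Fixpoint pstage k q j : xvec :=
  if j is j'.+1 then pstep (2 * (k - j'))%N (pstage k q j') else map_mx polyC q.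

Definition ppoly k q := pstage k q k.

Lemma vcoef_pstage_gt k q j l : (j < l)%N -> vcoef l (pstage k q j) = 0.
Proof.
elim: j l => [|j IHj] [//|l] lt_jl /=.
  by apply/matrixP => i i'; rewrite !mxE coefC.
by rewrite vcoef_pstepS !IHj ?raddf0 ?mul0rn ?addr0 ?subr0 //; lia.
Qed.

Lemma vcoef_pstage0 k q : vcoef 0 (pstage k q 0) = q.
Proof. by apply/matrixP => i j; rewrite [LHS]mxE [map_mx _ _ _ _]mxE coefC. Qed.

(** The constant 2 (k - j) + j collects 2 (k - j) from the power of Q and j from
    the derivative of x^j. *)
Lemma vcoef_pstage_lead k q j :
  vcoef j.+1 (pstage k q j.+1) = vcoef j (pstage k q j) *+ (2 * (k - j) + j)
    + lie S (vcoef j (pstage k q j)).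
Proof.
have /= := vcoef_pstepS (2 * (k - j)) (pstage k q j) j => ->.
rewrite (vcoef_pstage_gt k q (leqnSn j.+1)) (vcoef_pstage_gt k q (leqnn j.+1)).
by rewrite raddf0 mul0rn subr0 addr0.
Qed.

Lemma homogv_pstage n k q j l : homogv n q -> homogv n (vcoef l (pstage k q j)).
Proof.
move=> hq; elim: j l => [|j IHj] l /=.
  by move=> i; rewrite !mxE coefC; case: eqP => _ //; exact: rpred0.
case: l => [|l].
  rewrite vcoef_pstep0 => i; rewrite mxE [X in _ + X]mxE.
  by apply: rpredB; [exact: homogv_lie | exact: IHj].
rewrite vcoef_pstepS => i; rewrite mxE; apply: rpredD; last exact: homogv_lie.
rewrite mxE [X in _ + X]mxE mulmxnE; apply: rpredB; last exact/rpredMn/IHj.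
rewrite mxE mulmxnE; apply: rpredD; first exact/rpredMn/IHj.
exact: homogv_lie.
Qed.

Hypothesis lie_inj : forall c q g, (0 < c)%N ->
  q *+ c + lie S q = g *+ c + lie S g -> q = g.
Variable n : nat.
Hypothesis lie_surj : forall c g, (0 < c)%N -> homogv n g ->
  exists2 q, homogv n q & q *+ c + lie S q = g.

(** The constants 2 (k - j) + j with j < k are positive, so each step is
    invertible on top coefficients. *)
Lemma pstage_lead_inj k q g j : (j <= k)%N ->
  vcoef j (pstage k q j) = vcoef j (pstage k g j) -> q = g.
Proof.
elim: j => [_|j IHj lt_jk]; first by rewrite !vcoef_pstage0.
rewrite !vcoef_pstage_lead => /lie_inj qg; apply: IHj; first exact: ltnW.
by apply: qg; lia.
Qed.

Lemma pstage_lead_surj k g j : (j <= k)%N -> homogv n g ->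
  exists2 q, homogv n q & vcoef j (pstage k q j) = g.
Proof.
elim: j g => [g _ hg|j IHj g lt_jk hg].
  by exists g => //; exact: vcoef_pstage0.
have c_gt0 : (0 < 2 * (k - j) + j)%N by lia.
have [g' hg' g'E] := lie_surj c_gt0 hg.
have [q hq qE] := IHj g' (ltnW lt_jk) hg'.
by exists q => //; rewrite vcoef_pstage_lead qE.
Qed.

(** Choose q_N to match the top coefficient and subtract. *)
Lemma ppoly_expansion N f : (forall l, homogv n (vcoef l f)) ->
  (forall l, (N <= l)%N -> vcoef l f = 0) ->
  exists q : nat -> vec, (forall j, homogv n (q j)) /\
    f = \sum_(j < N) ppoly j (q j).
Proof.
elim: N f => [|N IHN] f hf f_ge.
  exists (fun=> 0); split=> [j i|]; first by rewrite mxE rpred0.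
  by rewrite big_ord0; apply: vcoefP => l; rewrite f_ge // raddf0.
have [qN hqN qNE] := @pstage_lead_surj N _ N (leqnn N) (hf N).
have [l|l le_Nl|q [hq fE]] := IHN (f - ppoly N qN).
- rewrite raddfB => i; rewrite mxE [X in _ + X]mxE.
  by apply: rpredB; [exact: hf | exact: homogv_pstage].
- rewrite raddfB /=; case: ltngtP le_Nl => // [lt_Nl|<-] _.
    by rewrite f_ge // vcoef_pstage_gt // subr0.
  by rewrite qNE subrr.
exists (fun j => if j == N then qN else q j); split=> [j|].
  by case: eqP.
rewrite big_ord_recr /= eqxx -[f in LHS](subrK (ppoly N qN)) fE; congr (_ + _).
by apply: eq_bigr => j _; rewrite ltn_eqF.
Qed.

Lemma ppoly_sum_inj N (q g : nat -> vec) :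
  \sum_(j < N) ppoly j (q j) = \sum_(j < N) ppoly j (g j) ->
  forall j, (j < N)%N -> q j = g j.
Proof.
elim: N => [//|N IHN]; rewrite !big_ord_recr /= => qgE.
have low (h : nat -> vec) : vcoef N (\sum_(j < N) ppoly j (h j)) = 0.
  rewrite raddf_sum big1 // => j _; exact: vcoef_pstage_gt.
have qgN : q N = g N.
  apply: (@pstage_lead_inj N _ _ N (leqnn N)).
  by have := congr1 (vcoef N) qgE; rewrite !raddfD /= !low !add0r.
move=> j; rewrite ltnS leq_eqVlt => /predU1P[-> //|]; apply: IHN.
by move: qgE; rewrite qgN => /addIr.
Qed.

End Recurrence.

(** * Derivatives of matrix-valued functions *)

Section Deriv.
Variable K : numFieldType.
Implicit Types t : K.

Lemma is_derive_mul t (f g : K -> K) df dg :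
  is_derive t 1 f df -> is_derive t 1 g dg ->
  is_derive t 1 (fun s => f s * g s) (f t * dg + df * g t).
Proof.
move=> hf hg; rewrite [df * _]mulrC.
exact: (@is_deriveM _ _ f g t 1 df dg).
Qed.

Lemma is_derive_bigsum n t (f : 'I_n -> K -> K) df :
  (forall i, is_derive t 1 (f i) (df i)) ->
  is_derive t 1 (fun s => \sum_i f i s) (\sum_i df i).
Proof.
move=> hf; have -> : (fun s => \sum_i f i s) = \sum_i f i.
  by apply/funext => s; rewrite fct_sumE.
exact: is_derive_sum.
Qed.

Lemma derivable_det n t (F : K -> 'M[K]_n) :
  (forall i j, derivable (fun s => F s i j) t 1) ->
  derivable (fun s => \det (F s)) t 1.
Proof.
move=> hF; rewrite /determinant.
have -> : (fun s => \sum_(p : 'S_n) (-1) ^+ p * \prod_i F s i (p i)) =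
          \sum_(p : 'S_n) (cst ((-1) ^+ p) * \prod_i (fun s => F s i (p i))).
  apply/funext => s; rewrite fct_sumE; apply: eq_bigr => p _ /=.
  by rewrite /GRing.mul /= fct_prodE.
apply: (big_ind (fun f : K -> K => derivable f t 1)).
- exact: (@derivable_cst K K K 0 t 1).
- by move=> f g; exact: derivableD.
move=> p _; apply: derivableM; first exact: derivable_cst.
apply: (big_ind (fun f : K -> K => derivable f t 1)) => //.
by move=> f g; exact: derivableM.
Qed.

Definition mx_derive m n t (F : K -> 'M[K]_(m, n)) (dF : 'M[K]_(m, n)) :=
  forall i j, is_derive t 1 (fun s => F s i j) (dF i j).

Lemma mx_deriveM m n p t (F : K -> 'M[K]_(m, n)) (G : K -> 'M[K]_(n, p)) dF dG :
  mx_derive t F dF -> mx_derive t G dG ->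
  mx_derive t (fun s => F s *m G s) (F t *m dG + dF *m G t).
Proof.
move=> hF hG i j; under eq_fun do rewrite mxE.
rewrite !mxE -big_split; apply: is_derive_bigsum => l.
exact: is_derive_mul.
Qed.

Lemma mx_derive_cst m n t (A : 'M[K]_(m, n)) : mx_derive t (fun=> A) 0.
Proof. by move=> i j; rewrite mxE; exact: is_derive_cst. Qed.

Lemma mx_derive_unique m n t (F : K -> 'M[K]_(m, n)) dF dF' :
  mx_derive t F dF -> mx_derive t F dF' -> dF = dF'.
Proof.
move=> h h'; apply/matrixP => i j.
by have [_ <-] := h i j; have [_ <-] := h' i j.
Qed.

Lemma mx_derive_near m n t (F G : K -> 'M[K]_(m, n)) dF :
  (\forall s \near t, F s = G s) -> mx_derive t F dF -> mx_derive t G dF.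
Proof.
move=> FG hF i j; apply: near_eq_is_derive (hF i j).
by apply: filterS FG => s ->.
Qed.

(** Differentiability comes from Cramer's formula; the value of the derivative
    is then found from F^-1 F = 1. *)
Lemma mx_derivable_inv n t (F : K -> 'M[K]_n) :
  (forall i j, derivable (fun s => F s i j) t 1) ->
  (\forall s \near t, F s \in unitmx) ->
  forall i j, derivable (fun s => invmx (F s) i j) t 1.
Proof.
move=> hF Fu i j; pose f s := (\det (F s))^-1 * cofactor (F s) j i.
have fE : \forall s \near t, f s = invmx (F s) i j.
  by apply: filterS Fu => s Fsu; rewrite /invmx Fsu !mxE.
apply: near_eq_derivable fE _.
have -> : f = (fun s => (\det (F s))^-1) * (fun s => cofactor (F s) j i) by [].
apply: derivableM.
  apply: derivableV; last exact: derivable_det.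
  by rewrite -unitfE -unitmxE; exact: nbhs_singleton Fu.
rewrite /cofactor.
have -> : (fun s => (-1) ^+ (j + i) * \det (row' j (col' i (F s)))) =
   cst ((-1) ^+ (j + i)) * (fun s => \det (row' j (col' i (F s)))) by [].
apply: derivableM; first exact: derivable_cst.
apply: derivable_det => a b.
by under eq_fun do rewrite !mxE; exact: hF.
Qed.

Lemma mx_derive_inv n t (F : K -> 'M[K]_n) dF :
  mx_derive t F dF -> (\forall s \near t, F s \in unitmx) ->
  mx_derive t (fun s => invmx (F s)) (- (invmx (F t) *m dF *m invmx (F t))).
Proof.
move=> hF Fu; have Ftu : F t \in unitmx by exact: nbhs_singleton Fu.
pose G s := invmx (F s).
pose dG : 'M[K]_n := \matrix_(i, j) derive (fun s => G s i j) t 1.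
have hG : mx_derive t G dG.
  move=> i j; rewrite mxE; apply: derivableP; apply: mx_derivable_inv => // a b.
  by have [] := hF a b.
have GF1 : \forall s \near t, 1%:M = G s *m F s.
  by apply: filterS Fu => s Fsu; rewrite mulVmx.
have := mx_derive_unique (mx_derive_near GF1 (@mx_derive_cst n n t 1%:M))
  (mx_deriveM hG hF).
rewrite addrC => /esym/eqP; rewrite addr_eq0 => /eqP dGF.
suff <- : dG = - (invmx (F t) *m dF *m invmx (F t)) by [].
by rewrite -mulNmx -dGF mulmxK.
Qed.

End Deriv.

Lemma near_neq (K : numFieldType) (x y : K) :
  x != y -> \forall t \near x, t != y.
Proof.
move=> neq_xy; have : open (~` [set y])%classic.
  apply/closed_openC/accessible_closed_set1/hausdorff_accessible.
  exact: norm_hausdorff.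
move=> oy; suff : nbhs x (~` [set y])%classic by apply: filterS => t /eqP.
by apply: open_nbhs_nbhs; split => //; exact/eqP.
Qed.

(** * The chain rule for polynomials *)

Section Chain.
Variables (K : numFieldType) (d : nat).
Implicit Types (t : K) (M : 'M[K]_d) (w : 'cV[K]_d).

Lemma is_derive_meval t (y : K -> 'I_d -> K) dy (p : mpoly d K) :
  (forall l, is_derive t 1 (fun s => y s l) (dy l)) ->
  is_derive t 1 (fun s => meval (y s) p)
    (\sum_l dy l * meval (y t) (mderiv l p)).
Proof.
move=> hy; elim/mpoly_gen_ind: p => [c|i|p q hp hq|p q hp hq].
- under eq_fun do rewrite mevalC.
  rewrite big1 => [|l _]; first exact: is_derive_cst.
  by rewrite mderivC meval0 mulr0.
- under eq_fun do rewrite mevalXU.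
  rewrite (bigD1 i) //= mderiv_var eqxx meval1 mulr1 big1 ?addr0 // => l neq_li.
  by rewrite mderiv_var eq_sym (negbTE neq_li) meval0 mulr0.
- under eq_fun do rewrite mevalD.
  have -> : \sum_l dy l * meval (y t) (mderiv l (p + q)) =
     \sum_l dy l * meval (y t) (mderiv l p) +
     \sum_l dy l * meval (y t) (mderiv l q).
    rewrite -big_split; apply: eq_bigr => l _ /=.
    by rewrite mderivD mevalD mulrDr.
  exact: is_deriveD.
- under eq_fun do rewrite mevalM.
  have -> : \sum_l dy l * meval (y t) (mderiv l (p * q)) =
     meval (y t) p * (\sum_l dy l * meval (y t) (mderiv l q)) +
     (\sum_l dy l * meval (y t) (mderiv l p)) * meval (y t) q.
    rewrite mulr_sumr mulr_suml -big_split; apply: eq_bigr => l _ /=.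
    by rewrite mderivM mevalD !mevalM; ring.
  exact: is_derive_mul.
Qed.

Lemma mcoeff_mnm0 (p : mpoly d K) :
  mcoeff (mnm0 (n := d)) p = meval (fun=> 0) p.
Proof.
elim/mpoly_gen_ind: p => [c|i|p q hp hq|p q hp hq].
- by rewrite mcoeffC mevalC eqxx mulr1.
- by rewrite mcoeffX mevalXU mnm1_eq0.
- by rewrite mcoeffD mevalD hp hq.
- by rewrite rmorphM mevalM /= hp hq.
Qed.

(** By induction on the degree of m, the coefficient of w^m vanishes: the
    partial derivatives of p also vanish everywhere, as derivatives of functions
    that are zero, and in characteristic 0 they determine all coefficients but
    the constant one, which is p(0). *)
Lemma meval_eq0 (p : mpoly d K) :
  (forall w : 'I_d -> K, meval w p = 0) -> p = 0.
Proof.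
move=> p0; apply/mpolyP => m; rewrite mcoeff0.
elim: {m}(mdeg m) {-2}m p p0 (leqnn (mdeg m)) => [|e IHe] m p p0.
  by rewrite leqn0 mdeg_eq0 => /eqP ->; rewrite mcoeff_mnm0.
have [->|] := eqVneq m mnm0; first by rewrite mcoeff_mnm0.
move=> m_neq0 m_le.
have [l ml] : exists l, m l != 0%N.
  apply/existsP; apply: contraNT m_neq0; rewrite negb_exists => /forallP m0.
  by apply/eqP/mnmP => l; rewrite mnmE; apply/eqP; have := m0 l; rewrite negbK.
have mE : m = mnm_add (mnm_sub m (mnm1 l)) (mnm1 l) by rewrite submK // lep1mP.
have : mcoeff (mnm_sub m (mnm1 l)) (mderiv l p) = 0.
  apply: IHe => [w|]; last first.
    by move: m_le; rewrite {1}mE mdegD mdeg1 addn1.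
  (* the line through w in the direction of w_l *)
  have hy i : is_derive (0 : K) 1 (fun s => w i + s * (i == l)%:R) (i == l)%:R.
    have := is_deriveD (is_derive_cst (w i) (0 : K) 1) (is_derive_mul
      (is_derive_id (0 : K) 1) (is_derive_cst ((i == l)%:R : K) (0 : K) 1)).
    by rewrite add0r mulr0 add0r mul1r.
  have [_ dp] := is_derive_meval p hy; move: dp.
  under [X in derive X]eq_fun do rewrite p0.
  rewrite derive_cst (bigD1 l) //= eqxx mul1r big1 => [|i neq_il].
    rewrite addr0 => /esym dp; rewrite -[RHS]dp.
    by apply: meval_eq => i; rewrite mul0r addr0.
  by rewrite (negbTE neq_il) mul0r.
rewrite mcoeff_mderiv -mE => /eqP; rewrite -mulr_natl mulf_eq0 pnatr_eq0.
by move=> /eqP.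
Qed.

Definition xmeval t w (f : {poly mpoly d K}) : K :=
  meval (fun i => w i 0) f.[mpolyC d t].

Lemma xmevalD t w f g : xmeval t w (f + g) = xmeval t w f + xmeval t w g.
Proof. by rewrite /xmeval hornerD mevalD. Qed.

Lemma xmevalM t w f g : xmeval t w (f * g) = xmeval t w f * xmeval t w g.
Proof. by rewrite /xmeval hornerM mevalM. Qed.

Lemma xmevalC t w p : xmeval t w p%:P = meval (fun i => w i 0) p.
Proof. by rewrite /xmeval hornerC. Qed.

Lemma xmevalX t w : xmeval t w 'X = t.
Proof. by rewrite /xmeval hornerX mevalC. Qed.

Lemma xmevalE t w f : xmeval t w f = (map_poly (meval (fun i => w i 0)) f).[t].
Proof.
by rewrite /xmeval -[in RHS](mevalC (fun i => w i 0) t) horner_map.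
Qed.

Lemma meval_linform M w l :
  meval (fun i => w i 0) (linform M l) = (M *m w) l 0.
Proof.
rewrite /linform raddf_sum mxE; apply: eq_bigr => m _ /=.
by rewrite mevalZ mevalXU.
Qed.

(** Along a solution of y' = M y, the function f(t, y(t)) is differentiated by
    f |-> f_x + (D_w f)[M w]. *)
Lemma is_derive_xmeval t M (y : K -> 'cV[K]_d) (f : {poly mpoly d K}) :
  mx_derive t y (M *m y t) ->
  is_derive t 1 (fun s => xmeval s (y s) f)
   (xmeval t (y t) (f^`() + map_poly (lder M) f)).
Proof.
move=> hy; elim/poly_ind: f => [|f p IHf].
  under eq_fun do rewrite /xmeval horner0 meval0.
  rewrite deriv0 raddf0 addr0 /xmeval horner0 meval0.
  exact: is_derive_cst.
under eq_fun do rewrite xmevalD xmevalM xmevalC xmevalX.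
have -> : xmeval t (y t)
    ((f * 'X + p%:P)^`() + map_poly (lder M) (f * 'X + p%:P)) =
  (xmeval t (y t) f * 1 +
   xmeval t (y t) (f^`() + map_poly (lder M) f) * t) +
  \sum_l (M *m y t) l 0 * meval (fun i => y t i 0) (mderiv l p).
  have -> : map_poly (lder M) (f * 'X + p%:P) =
      map_poly (lder M) f * 'X + (lder M p)%:P.
    rewrite raddfD /= map_polyC; congr (_ + _); apply/polyP => i.
    by rewrite coefMX !coef_map coefMX; case: i => [|i] //=; rewrite ?raddf0.
  rewrite derivD derivM derivX derivC mulr1 addr0.
  rewrite !(xmevalD, xmevalM, xmevalX, xmevalC).
  rewrite /lder raddf_sum /=.
  under [X in _ = _ + X]eq_bigr => l _ do rewrite -meval_linform -mevalM.
  by ring.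
apply: is_deriveD.
  by apply: is_derive_mul; exact: is_derive_id.
by apply: is_derive_meval => l; exact: hy.
Qed.

End Chain.

(** * Values of the recurrence step *)

Section Evaluation.
Variables (K : numFieldType) (d : nat).
Implicit Types (t : K) (w v : 'cV[K]_d) (r f : 'cV[{poly mpoly d K}]_d).
Implicit Types (S C M T : 'M[K]_d).

Lemma vxevalE f t w i : vxeval f t w i 0 = xmeval t w (f i 0).
Proof. by rewrite !mxE. Qed.

Lemma xmeval_lder_comb S C a b t w (p : {poly mpoly d K}) :
  xmeval t w (map_poly (lder (a *: S + b *: C)) p) =
  a * xmeval t w (map_poly (lder S) p) + b * xmeval t w (map_poly (lder C) p).
Proof.
have -> : map_poly (lder (a *: S + b *: C)) p =
    (mpolyC d a)%:P * map_poly (lder S) p +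
    (mpolyC d b)%:P * map_poly (lder C) p.
  apply/polyP => l; rewrite coefD !coefCM !coef_map /=.
  by rewrite lder_scale_add !mul_mpolyC.
by rewrite xmevalD !xmevalM !xmevalC !mevalC.
Qed.

Lemma xmeval_xlie T t w r i :
  xmeval t w (xlie T r i 0) =
  xmeval t w (map_poly (lder T) (r i 0)) - (T *m vxeval r t w) i 0.
Proof.
rewrite mxE [X in _ + X]mxE [X in _ - X]mxE xmevalD; congr (_ + _).
  by rewrite mxE.
rewrite /xmeval hornerN raddfN; congr (- _).
rewrite horner_sum raddf_sum mxE; apply: eq_bigr => m _.
by rewrite /= hornerM mevalM !mxE hornerC mevalC.
Qed.

(** The argument of [xmeval] has the shape of a component of [pstep], with p and
    q in place of the two bracket terms. *)
Lemma xmeval_stepE c t w (f p q : {poly mpoly d K}) a b :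
  xmeval t w p = a -> xmeval t w q = b ->
  xmeval t w ('X * (f *+ c + p) + ('X^2 - 1) * f^`() + q) =
  t * (c%:R * xmeval t w f + a) + Qpol t * xmeval t w f^`() + b.
Proof.
move=> <- <-; rewrite !xmevalD !xmevalM xmevalD xmevalX.
have -> : xmeval t w ('X^2 - 1) = Qpol t.
  by rewrite xmevalE rmorphB rmorph1 /= map_polyXn !hornerE.
by rewrite [xmeval t w (f *+ c)]xmevalE rmorphMn hornerMn -xmevalE mulr_natl.
Qed.

(** The total derivative r_x + (D_w r)[M w] at (t, w). *)
Definition vxderiv M r t w : 'cV[K]_d :=
  \col_i xmeval t w ((r i 0)^`() + map_poly (lder M) (r i 0)).

(** Multiplying the derivation along M by Q makes it polynomial in t, as
    Q M = t S + C. *)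
Lemma vxeval_pstep S C M c r t w : Qpol t *: M = t *: S + C ->
  vxeval (pstep S C c r) t w = (t *+ c) *: vxeval r t w +
    Qpol t *: (vxderiv M r t w - M *m vxeval r t w).
Proof.
move=> QM; rewrite scalerBr scalemxAl QM.
apply/matrixP => i j; rewrite (ord1 j) vxevalE.
have -> : pstep S C c r i 0 = 'X * (r i 0 *+ c + xlie S r i 0)
    + ('X^2 - 1) * (r i 0)^`() + xlie C r i 0.
  rewrite /pstep; move: (xlie S r) (xlie C r) => u v.
  by rewrite !mxE mulmxnE.
rewrite (xmeval_stepE c (r i 0) (xmeval_xlie S t w r i)
                                (xmeval_xlie C t w r i)).
have dE : Qpol t * vxderiv M r t w i 0 = Qpol t * xmeval t w (r i 0)^`() +
    (t * xmeval t w (map_poly (lder S) (r i 0)) +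
     xmeval t w (map_poly (lder C) (r i 0))).
  rewrite mxE xmevalD mulrDr; congr (_ + _).
  rewrite -[X in _ = _ + X]mul1r -xmeval_lder_comb scale1r -QM.
  have -> : Qpol t *: M = Qpol t *: M + 0 *: M by rewrite scale0r addr0.
  by rewrite xmeval_lder_comb mul0r addr0.
have rhsE (u v : 'cV[K]_d) :
    ((t *+ c) *: u + (Qpol t *: vxderiv M r t w - v)) i 0 =
    t * (c%:R * u i 0) + (Qpol t * vxderiv M r t w i 0 - v i 0).
  rewrite -[t *+ c]mulr_natr; move: (vxderiv M r t w) => z.
  by rewrite !mxE mulrA.
rewrite rhsE dE -vxevalE mulmxDl -scalemxAl.
move: (vxeval r t w) => u; move: (S *m u) (C *m u) => us uc.
by rewrite !mxE; ring.
Qed.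

Lemma is_derive_vxeval M r t (y : K -> 'cV[K]_d) :
  mx_derive t y (M *m y t) ->
  mx_derive t (fun s => vxeval r s (y s)) (vxderiv M r t (y t)).
Proof.
move=> hy i j; rewrite (ord1 j); under eq_fun do rewrite vxevalE.
by rewrite mxE; exact: is_derive_xmeval.
Qed.

End Evaluation.

(** * Derivatives along the flow of the differential equation *)

Section Flow.
Variables (K : numFieldType) (d : nat) (A B : 'M[K]_d).
Implicit Types (t : K) (w v : 'cV[K]_d) (r f : 'cV[{poly mpoly d K}]_d).
Local Notation S := (A + B).
Local Notation C := (A - B).

Lemma Qpol_Mmat t : t != 1 -> t != -1 -> Qpol t *: Mmat A B t = t *: S + C.
Proof.
move=> t1 tN1; have h1 : t - 1 != 0 by rewrite subr_eq0.
have h2 : t + 1 != 0 by rewrite addr_eq0.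
by apply/matrixP => i j; rewrite !mxE /Qpol; field; rewrite h1 h2.
Qed.

Variable Y : K -> 'M[K]_d.

Definition pullback v r t : 'cV[K]_d := invmx (Y t) *m vxeval r t (Y t *m v).

(** The product rule with (Y^-1)' = - Y^-1 M; the bracket arises here. *)
Lemma mx_derive_pullback v r t : t != 1 -> t != -1 ->
  mx_derive t Y (Mmat A B t *m Y t) -> (\forall s \near t, Y s \in unitmx) ->
  mx_derive t (pullback v r) (invmx (Y t) *m
     (vxderiv (Mmat A B t) r t (Y t *m v) -
      Mmat A B t *m vxeval r t (Y t *m v))).
Proof.
move=> t1 tN1 hY Yu; have Ytu : Y t \in unitmx by exact: nbhs_singleton Yu.
have hy : mx_derive t (fun s => Y s *m v) (Mmat A B t *m (Y t *m v)).
  have := mx_deriveM hY (mx_derive_cst t v).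
  by rewrite mulmx0 add0r mulmxA.
have := mx_deriveM (mx_derive_inv hY Yu) (is_derive_vxeval r hy).
by rewrite mulmxBr mulmxA mulmxK // mulNmx -mulmxA.
Qed.

Lemma is_derive_Qpol_exp e t :
  is_derive t 1 (fun s : K => Qpol s ^+ e) ((t *+ (2 * e)) * Qpol t ^+ e.-1).
Proof.
have hQ : is_derive t 1 (@Qpol K) (t *+ 2).
  have -> : t *+ 2 = (t * 1 + 1 * t) - 0 by rewrite subr0 mulr1 mul1r mulr2n.
  have -> : @Qpol K = fun s : K => s * s - 1.
    by apply/funext => s; rewrite /Qpol expr2.
  apply: is_deriveB.
  by apply: is_derive_mul; exact: is_derive_id.
elim: e => [|e IHe].
  under eq_fun do rewrite expr0.
  by rewrite muln0 mulr0n mul0r; exact: is_derive_cst.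
under eq_fun do rewrite exprS.
have -> : (t *+ (2 * e.+1)) * Qpol t ^+ e.+1.-1 =
   Qpol t * ((t *+ (2 * e)) * Qpol t ^+ e.-1) + (t *+ 2) * Qpol t ^+ e.
  rewrite mulnS mulrnDr /= mulrDl addrC; congr (_ + _).
  case: e {IHe} => [|e]; first by rewrite muln0 mulr0n mul0r mulr0.
  by rewrite exprS mulrCA.
exact: is_derive_mul.
Qed.

(** The j-th derivative of Q^k Y^-1 q(Y v), for j <= k. *)
Definition Pop_stage v k q j t : 'cV[K]_d :=
  Qpol t ^+ (k - j) *: pullback v (pstage S C k q j) t.

Lemma mx_derive_Pop_stage v k q j t : (j < k)%N -> t != 1 -> t != -1 ->
  mx_derive t Y (Mmat A B t *m Y t) -> (\forall s \near t, Y s \in unitmx) ->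
  mx_derive t (Pop_stage v k q j) (Pop_stage v k q j.+1 t).
Proof.
move=> lt_jk t1 tN1 hY Yu; rewrite /Pop_stage.
have -> : pstage S C k q j.+1 =
  pstep S C (2 * (k - j)) (pstage S C k q j) by [].
move: (pstage S C k q j) => r; have -> : (k - j = (k - j.+1).+1)%N by lia.
move: (k - j.+1)%N => e; have hp := mx_derive_pullback v r t1 tN1 hY Yu.
move=> i i'.
have -> : (fun s => (Qpol s ^+ e.+1 *: pullback v r s) i i') =
          (fun s => Qpol s ^+ e.+1 * pullback v r s i i').
  by apply/funext => s; rewrite mxE.
have := is_derive_mul (is_derive_Qpol_exp e.+1 t) (hp i i').
congr (is_derive _ _ _ _).
rewrite [in RHS]/pullback (vxeval_pstep _ _ _ (Qpol_Mmat t1 tN1)).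
rewrite [in RHS]mulmxDr -!scalemxAr -/(pullback v r t).
set z := invmx _ *m (_ - _).
rewrite exprS /=; move: (pullback v r t) z => u z; rewrite !mxE; ring.
Qed.

(** The induction on j needs the equality on a neighbourhood of x, because the
    next derivative depends on nearby values. *)
Lemma derive1n_Pop_stage v k q x i : x != 1 -> x != -1 ->
  fundamental_near A B x Y -> forall j, (j <= k)%N ->
  \forall t \near x, derive1n j (fun s : K => Pop_stage v k q 0 s i 0 : K) t
    = Pop_stage v k q j t i 0.
Proof.
move=> x1 xN1 hY; elim=> [_|j IHj lt_jk]; first exact: filterE.
have Yu : \forall t \near x, Y t \in unitmx by apply: filterS hY => t [].
have IHj2 := near_join (IHj (ltnW lt_jk)); have Yu2 := near_join Yu.
near=> t.
rewrite derive1nS derive1E.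
have /near_eq_derive -> : \forall s \near t,
    derive1n j (fun s : K => Pop_stage v k q 0 s i 0 : K) s
      = Pop_stage v k q j s i 0.
  by near: t.
suff /(_ i 0)[] :
  mx_derive t (Pop_stage v k q j) (Pop_stage v k q j.+1 t) by [].
apply: mx_derive_Pop_stage => //.
- by near: t; exact: near_neq.
- by near: t; exact: near_neq.
- have [_ hYt] : Y t \in unitmx /\ forall i j,
      derivable (fun s : K => Y s i j : K) t 1 /\
      derive1 (fun s : K => Y s i j : K) t = (Mmat A B t *m Y t) i j.
    by near: t.
  move=> a b; have [h1 h2] := hYt a b; rewrite -h2 derive1E; exact: derivableP.
- by near: t.
Unshelve. all: by end_near. Qed.

(** P_k is given by the recurrence: at stage k no power of Q is left, and
    Y(x) v = w. *)
Lemma PopE k x q w : x != 1 -> x != -1 -> fundamental_near A B x Y ->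
  Pop Y k x q w = vxeval (ppoly S C k q) x w.
Proof.
move=> x1 xN1 hY; have [Yxu _] := nbhs_singleton hY.
pose v := invmx (Y x) *m w.
have wE : Y x *m v = w by rewrite mulKVmx.
rewrite /Pop -[RHS](mulKVmx Yxu); congr (_ *m _); apply/matrixP => i j.
rewrite (ord1 j) mxE.
have := nbhs_singleton (derive1n_Pop_stage v q i x1 xN1 hY (leqnn k)).
rewrite {2}/Pop_stage subnn expr0 scale1r /pullback wE => <-.
congr (derive1n k _ x); apply/funext => t; rewrite /Pop_stage subn0.
rewrite /pullback -mulmxA -/v; congr ((_ *: (_ *m _)) i 0).
by apply/matrixP => a b; rewrite !mxE hornerC.
Qed.

End Flow.

(** * Existence and uniqueness of the expansion *)

Section Expansion.
Variables (K : numFieldType) (d : nat).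

(** The integers 2, 3, 4, ... give infinitely many roots. *)
Lemma horner_eq0_pm1 (p : {poly K}) :
  (forall t, t != 1 -> t != -1 -> p.[t] = 0) -> p = 0.
Proof.
move=> p0; apply/eqP; apply: contraT => p_neq0.
pose rs := [seq m.+2%:R : K | m <- iota 0 (size p)].
have : (size rs < size p)%N.
  apply: max_poly_roots => //; last first.
    rewrite map_inj_uniq ?iota_uniq // => m m' /eqP.
    by rewrite eqr_nat => /eqP[].
  apply/allP => _ /mapP[m _ ->]; apply/eqP/p0.
    by rewrite (eqr_nat K _ 1).
  by rewrite -addr_eq0 -(natrD K _ 1) pnatr_eq0.
by rewrite size_map size_iota ltnn.
Qed.

Lemma vxeval_inj (f g : vxpoly K d) :
  (forall t, t != 1 -> t != -1 -> forall w, vxeval f t w = vxeval g t w) ->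
  f = g.
Proof.
move=> fg; apply/matrixP => i j; rewrite (ord1 j); apply/polyP => l.
apply/eqP; rewrite -subr_eq0; apply/eqP; apply: meval_eq0 => w.
pose w' : 'cV[K]_d := \col_i w i.
have -> : meval w ((f i 0)`_l - (g i 0)`_l) =
   (map_poly (meval (fun i => w' i 0)) (f i 0 - g i 0))`_l.
  by rewrite coef_map coefB; apply: meval_eq => a; rewrite mxE.
rewrite [map_poly _ _]horner_eq0_pm1 ?coef0 // => t t1 tN1.
rewrite -xmevalE /xmeval hornerD hornerN mevalB -!/(xmeval _ _ _).
by rewrite -!vxevalE fg // subrr.
Qed.

Lemma vxeval_sum n (r : 'I_n -> vxpoly K d) t w :
  vxeval (\sum_j r j) t w = \sum_j vxeval (r j) t w.
Proof.
apply: (big_morph (fun r => vxeval r t w)) => [r1 r2|].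
  apply/matrixP => i j; rewrite (ord1 j) [RHS]mxE !vxevalE -xmevalD.
  by rewrite mxE.
by apply/matrixP => i j; rewrite (ord1 j) vxevalE !mxE /xmeval horner0 meval0.
Qed.

(** The exponents are grouped by eigenvalue: if a_l = lam (s l), then
    m . a = m' . lam, where m'_j is the sum of the m_l with s l = j. *)
Lemma nonresonant_neq0 (S P : 'M[K]_d) (a : 'rV[K]_d) lam c :
  P \in unitmx -> P *m S = diag_mx a *m P -> eigenvalue_list S lam ->
  nonresonant lam -> (0 < c)%N ->
  forall (m : 'I_d -> nat) i, c%:R + (\sum_l a 0 l *+ m l - a 0 i) != 0.
Proof.
move=> Pu PS hlam hres; case: c => // c _ m i.
have [s aE] := diagonalization_spectrum Pu PS hlam.
have := hres (fun j => \sum_(l | s l == j) m l)%N (s i) c.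
apply: contra_neq => /eqP; rewrite addrC addr_eq0 aE => /eqP <-.
congr (_ - _); rewrite [RHS](partition_big s xpredT) //=.
apply: eq_bigr => j _; rewrite natr_sum mulr_suml.
by apply: eq_bigr => l /eqP <-; rewrite aE mulr_natl.
Qed.

(** By [PopE] the question becomes one about the polynomials [ppoly], where the
    inductions on the degree apply with N = k + 1. *)
Lemma Pop_expansion (A B : 'M[K]_d) (lam : 'I_d -> K) (Y : K -> K -> 'M[K]_d)
  (n k : nat) (f : vxpoly K d) :
  diagonalizable (A + B) -> eigenvalue_list (A + B) lam -> nonresonant lam ->
  (forall x, x != 1 -> x != -1 -> fundamental_near A B x (Y x)) ->
  in_Pnx n f -> xdeg_le k f ->
  exists! q : {ffun 'I_k.+1 -> vpoly K d},
    (forall j, in_Pn n (q j)) /\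
    (forall x, x != 1 -> x != -1 -> forall w : 'cV[K]_d,
       vxeval f x w = \sum_(j < k.+1) Pop (Y x) j x (q j) w).
Proof.
move=> [P Pu /similar_diagPex[a /(similarP Pu) PS]] hlam hres hY hf hfk.
have nz := nonresonant_neq0 Pu PS hlam hres.
have inj c q g c0 := @lie_diagonalizable_inj K d _ c P a q g Pu PS (nz c c0).
have surj c g c0 := @lie_diagonalizable_surj K d n _ c P a g Pu PS (nz c c0).
have sumE x (q : nat -> vpoly K d) w : x != 1 -> x != -1 ->
    vxeval (\sum_(j < k.+1) ppoly (A + B) (A - B) j (q j)) x w =
    \sum_(j < k.+1) Pop (Y x) j x (q j) w.
  move=> x1 xN1; rewrite vxeval_sum; apply: eq_bigr => j _.
  by rewrite (PopE _ _ _ x1 xN1 (hY x x1 xN1)).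
have [l i|l lt_kl|q [hq fE]] :=
  ppoly_expansion (A - B) surj (N := k.+1) (f := f).
- by rewrite mxE; exact: hf.
- apply/matrixP => i j; rewrite (ord1 j) !mxE nth_default //.
  exact: leq_trans (hfk i) lt_kl.
exists [ffun j : 'I_k.+1 => q j]; split.
  split=> [j|x x1 xN1 w]; first by rewrite ffunE; exact: hq.
  rewrite fE sumE //; apply: eq_bigr => j _; by rewrite ffunE.
move=> q' [hq' fE']; apply/ffunP => j; rewrite ffunE.
pose g l := q' (inord l).
rewrite (@ppoly_sum_inj _ _ (A + B) (A - B) inj k.+1 q g) /g ?inord_val //.
apply: vxeval_inj => x x1 xN1 w; rewrite -fE (sumE x g) // fE' //.
by apply: eq_bigr => l _; rewrite /g inord_val.
Qed.
End Expansion.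

Theorem proposition4 (R : realType) (d : nat) (hd : (0 < d)%N)
  (A B : 'M[R[i]]_d) (lam : 'I_d -> R[i])
  (hdiag : diagonalizable (A + B))
  (hlam : eigenvalue_list (A + B) lam)
  (hres : nonresonant lam)
  (Y : R[i] -> R[i] -> 'M[R[i]]_d)
  (hY : forall x : R[i], x != 1 -> x != -1 -> fundamental_near A B x (Y x))
  (n k : nat) (f : vxpoly R[i] d)
  (hf : in_Pnx n f) (hfk : xdeg_le k f) :
  exists! q : {ffun 'I_k.+1 -> vpoly R[i] d},
    (forall j, in_Pn n (q j)) /\
    (forall x : R[i], x != 1 -> x != -1 -> forall w : 'cV[R[i]]_d,
       vxeval f x w = \sum_(j < k.+1) Pop (Y x) j x (q j) w).
Proof. exact: Pop_expansion hdiag hlam hres hY hf hfk. Qed.
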